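(* Let $x_0,\check x\in\mathbb R^2$ be fixed. Assume (N1)–(N3), (K1)–(K3) with $M>\nu+1$, and (X1)–(X2), where $\nu$ is the type in (X1). Then, as $\epsilon\to0$, $$\frac{\sum_{k}\sum_{j}\bigl|\mathcal H\varphi'(a_k-j+\vec\alpha_k\cdot\check x)\bigr|^3\,\mathbb E|\eta_{k,j}|^3}{\Bigl[\sum_{k}\sum_{j}\bigl(\mathcal H\varphi'(a_k-j+\vec\alpha_k\cdot\check x)\bigr)^2\,\mathbb E\eta_{k,j}^2\Bigr]^{3/2}}=O(\epsilon^{1/2}).$$
   Context: Fix $\kappa>0$ and $\bar p\in\mathbb R$. For $\epsilon>0$ set $\Delta p=\epsilon$, $\Delta\alpha=\kappa\epsilon$, $\alpha_k=k\Delta\alpha$, $p_j=\bar p+j\epsilon$ ($k,j\in\mathbb Z$), and $\vec\alpha=(\cos\alpha,\sin\alpha)$. Sums over $k$ range over all $k\in\mathbb Z$ with $|\alpha_k|\le\pi$; sums over $j$ range over $\mathbb Z$. Noise: for each $\epsilon$, $\{\eta_{k,j}\}$ are independent real random variables (not necessarily identically distributed) with (N1) $\mathbb E\eta_{k,j}=0$; (N2) $\mathbb E\eta_{k,j}^2=\sigma^2(\alpha_k,p_j)\Delta\alpha$, where $\sigma$ is a fixed real function of $(\alpha,p)$, $2\pi$-periodic in $\alpha$, of class $C^1$, bounded with bounded first partial derivatives on the relevant domain; (N3) $\mathbb E|\eta_{k,j}|^3\le c(\Delta\alpha)^{3/2}$ with $c$ independent of $k,j,\epsilon$. Kernel $\varphi:\mathbb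 R\to\mathbb R$: (K1) compactly supported; (K2) $\varphi^{(M+1)}\in L^\infty(\mathbb R)$ for some integer $M\ge3$; (K3) $\int\varphi=1$. $\mathcal H$ is the Hilbert transform, $\mathcal Hg(t)=\frac1\pi\,\mathrm{p.v.}\!\int\frac{g(s)}{t-s}ds$, and $\mathcal H\varphi'$ is the Hilbert transform of $\varphi'$. For $x_0\in\mathbb R^2$ set $a_k=(\vec\alpha_k\cdot x_0-\bar p)/\epsilon$. For $r\in\mathbb R$, $\langle r\rangle=\operatorname{dist}(r,\mathbb Z)$. An irrational $s$ is of type $\nu>0$ if for every $\nu_1>\nu$ there is $c(s,\nu_1)>0$ with $m^{\nu_1}\langle ms\rangle\ge c(s,\nu_1)$ for all $m\in\mathbb N$. Assumptions on $x_0$: (X1) $\kappa|x_0|$ is irrational and of some finite type $\nu$; (X2) $\sigma^2(\alpha,\vec\alpha\cdot x_0)\neq0$ for all $\alpha$ in some nonempty open set $\Omega\subset[0,2\pi]$. *)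

(* Defs.v *)
From HB Require Import structures.
From mathcomp Require Import all_boot all_order all_algebra.
From mathcomp Require Import all_classical all_reals all_analysis.
Set Implicit Arguments. Unset Strict Implicit. Unset Printing Implicit Defensive.
Import Order.TTheory GRing.Theory Num.Theory.
Import numFieldNormedType.Exports.
Local Open Scope classical_set_scope.
Local Open Scope ring_scope.

Section Defs.
Variable R : realType.

Definition distZ (r : R) : R :=
  Num.min (r - (Num.floor r)%:~R) ((Num.ceil r)%:~R - r).

Definition irrational (s : R) : Prop := forall q : rat, s <> ratr q.

Definition of_type (s nu : R) : Prop :=
  irrational s /\
  forall nu1, nu < nu1 -> exists c : R, 0 < c /\
    forall m : nat, (0 < m)%N -> c <= (m%:R `^ nu1) * distZ (m%:R * s).

Definition hilbert (g : R -> R) (t : R) : R :=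
  pi^-1 * lim ((fun delta : R =>
     Rintegral lebesgue_measure [set s : R | delta < `|t - s|]
               (fun s => g s / (t - s))) @ 0^'+).

Definition dir (a : R) (x : R * R) : R := cos a * x.1 + sin a * x.2.
Definition norm2 (x : R * R) : R := Num.sqrt (x.1 ^+ 2 + x.2 ^+ 2).

Definition alpha_k (kappa eps : R) (k : int) : R := k%:~R * (kappa * eps).
Definition p_j (pbar eps : R) (j : int) : R := pbar + j%:~R * eps.

Definition index_set (kappa eps : R) : set (int * int) :=
  [set kj | `|alpha_k kappa eps kj.1| <= pi].

Definition sigma_ok (sigma : R -> R -> R) : Prop :=
  (forall a p, sigma (a + 2 * pi) p = sigma a p) /\
  (forall a p, derivable (fun a' => sigma a' p) a 1) /\
  (forall a p, derivable (fun p' => sigma a p') p 1) /\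
  continuous (fun z : R * R => derive1 (fun a' => sigma a' z.2) z.1) /\
  continuous (fun z : R * R => derive1 (fun p' => sigma z.1 p') z.2) /\
  (exists B : R, forall a p,
     `|sigma a p| <= B /\
     `|derive1 (fun a' => sigma a' p) a| <= B /\
     `|derive1 (fun p' => sigma a p') p| <= B).

(* (K1) compact support, (K2) phi^(M+1) in L^infty, i.e. phi is M times
   differentiable and phi^(M) is Lipschitz, (K3) int phi = 1 *)
Definition kernel_ok (M : nat) (phi : R -> R) : Prop :=
  (exists A : R, forall t, A < `|t| -> phi t = 0) /\
  (forall n, (n < M)%N -> forall x, derivable (derive1n n phi) x 1) /\
  (exists L : R, forall s t,
     `|derive1n M phi s - derive1n M phi t| <= L * `|s - t|) /\
  (\int[lebesgue_measure]_t (phi t)%:E = 1)%E.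

Definition mutually_independent d (T : measurableType d)
    (P : probability T R) (I : choiceType) (D : set I) (X : I -> T -> R) : Prop :=
  (forall i, D i -> measurable_fun setT (X i)) /\
  forall s : seq I, uniq s -> (forall i, i \in s -> D i) ->
  forall B : I -> set R, (forall i, measurable (B i)) ->
    P (\bigcap_(i in [set` s]) (X i @^-1` B i)) =
    (\prod_(i <- s) P (X i @^-1` B i))%E.

Definition noise_ok d (T : measurableType d) (P : probability T R)
    (kappa pbar : R) (sigma : R -> R -> R) (eta : R -> int -> int -> T -> R) : Prop :=
  (forall eps, 0 < eps ->
     mutually_independent P (index_set kappa eps)
       (fun kj => eta eps kj.1 kj.2)) /\
  (forall eps k j, 0 < eps -> index_set kappa eps (k, j) ->
     P.-integrable setT (fun w => (eta eps k j w)%:E) /\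
     (\int[P]_w (eta eps k j w)%:E = 0)%E) /\
  (forall eps k j, 0 < eps -> index_set kappa eps (k, j) ->
     (\int[P]_w ((eta eps k j w) ^+ 2)%:E =
     ((sigma (alpha_k kappa eps k) (p_j pbar eps j)) ^+ 2 * (kappa * eps))%:E)%E) /\
  (exists c : R, forall eps k j, 0 < eps -> index_set kappa eps (k, j) ->
     (\int[P]_w (`|eta eps k j w| ^+ 3)%:E <= (c * (kappa * eps) `^ (3 / 2))%:E)%E).

Definition arg_kj (kappa pbar eps : R) (x0 xc : R * R) (k j : int) : R :=
  (dir (alpha_k kappa eps k) x0 - pbar) / eps - j%:~R
  + dir (alpha_k kappa eps k) xc.

Definition numer d (T : measurableType d) (P : probability T R)
    (kappa pbar : R) (x0 xc : R * R) (phi : R -> R)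
    (eta : R -> int -> int -> T -> R) (eps : R) : \bar R :=
  \esum_(kj in index_set kappa eps)
    ((`|hilbert (derive1 phi) (arg_kj kappa pbar eps x0 xc kj.1 kj.2)| ^+ 3)%:E
     * \int[P]_w (`|eta eps kj.1 kj.2 w| ^+ 3)%:E)%E.

Definition denom d (T : measurableType d) (P : probability T R)
    (kappa pbar : R) (x0 xc : R * R) (phi : R -> R)
    (eta : R -> int -> int -> T -> R) (eps : R) : \bar R :=
  \esum_(kj in index_set kappa eps)
    (((hilbert (derive1 phi) (arg_kj kappa pbar eps x0 xc kj.1 kj.2)) ^+ 2)%:E
     * \int[P]_w ((eta eps kj.1 kj.2 w) ^+ 2)%:E)%E.

End Defs.

(* Main.v *)
(** Since phi has integral 1 and compact support, H phi'(t) ~ -1 / (pi t^2) as t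
    tends to infinity, so |H phi'| is bounded below on some interval [T, T + 1].
    For every k, some j puts the argument a_k - j + alpha_k . xc in that interval,
    and the corresponding p_j is within O(eps) of alpha_k . x0; hence the k with
    alpha_k in an interval where sigma(alpha, alpha . x0) is bounded away from 0
    already keep the denominator bounded below. On the other hand |H phi'(t)| <= C
    / (1 + |t|), so each sum over j is bounded uniformly in k, and as there are
    O(1 / eps) values of k the numerator is O(eps^(3/2) / eps). *)

Require Import Defs.
From HB Require Import structures.
From mathcomp Require Import all_boot all_order all_algebra.
From mathcomp Require Import all_classical all_reals all_analysis.
From mathcomp Require Import ring lra zify.
Import Order.TTheory GRing.Theory Num.Theory.
Import numFieldNormedType.Exports.
Local Open Scope classical_set_scope.
Local Open Scope ring_scope.
Set Implicit Arguments. Unset Strict Implicit. Unset Printing Implicit Defensive.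

(** * Regularity and support of the kernel *)

Lemma norm_sub_le_derive1 (R : realType) (f : R -> R) (L : R) :
  (forall x, derivable f x 1) -> (forall x, `|derive1 f x| <= L) ->
  forall x y, `|f x - f y| <= L * `|x - y|.
Proof.
move=> df bf.
suff H x y : x <= y -> `|f y - f x| <= L * `|y - x|.
  move=> x y; case: (leP x y) => [/H|/ltW /H//].
  by rewrite distrC (distrC y).
move=> xy.
have [||c _ ->] := @MVT_segment R f (derive1 f) x y xy.
- by move=> z _; rewrite derive1E; exact/derivableP.
- by apply: derivable_within_continuous => z _; exact: df.
by rewrite normrM ler_wpM2r.
Qed.

(** The strict inequality is an open condition, so [f] agrees with the zero function near [t]. *)
Lemma derive1_eq0_outside (R : realType) (f : R -> R) (A : R) :
  (forall t, A < `|t| -> f t = 0) -> forall t, A < `|t| -> derive1 f t = 0.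
Proof.
move=> f0 t At; rewrite derive1E.
have -> : 'D_1 f t = 'D_1 (fun=> 0 : R) t.
  apply: near_eq_derive.
  have : \forall s \near t, A < `|s|.
    by apply: (@cvgr_gt _ _ (nbhs t) _ (fun s => `|s|) `|t|) => //; exact: norm_continuous.
  by apply: filterS => s; exact: f0.
by rewrite derive_cst.
Qed.

Lemma derivable_bounded_outside (R : realType) (f : R -> R) (A : R) :
  (forall x, derivable f x 1) -> (forall t, A < `|t| -> f t = 0) ->
  exists2 B, 0 <= B & forall t, `|f t| <= B.
Proof.
move=> df f0.
have [/= A0|A0] := ltP A 0.
  by exists 0 => // t; rewrite f0 ?normr0// (lt_le_trans A0).
have cf : {within `[-A, A], continuous (fun x => `|f x|)}.
  apply: continuous_subspaceT => x.
  apply: (@continuous_comp _ _ _ f (fun y : R => `|y|)); last exact: norm_continuous.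
  exact/differentiable_continuous/derivable1_diffP.
have [|c _ cmax] := EVT_max _ cf; first by lra.
exists `|f c| => // t; have [tA|/f0 ->] := leP `|t| A; last by rewrite normr0.
by apply: cmax; rewrite in_itv/= -ler_norml.
Qed.

(** With [3 <= M], [phi] and its first two derivatives are differentiable. The second derivative is
    then bounded, by compactness, and its bound is a Lipschitz constant for the first. *)
Lemma kernel_facts (R : realType) (M : nat) (phi : R -> R) :
  (3 <= M)%N -> kernel_ok M phi ->
  exists A B L : R, [/\ 1 <= A, 0 <= B & 0 <= L] /\
   [/\ forall x, derivable phi x 1,
       continuous (derive1 phi),
       forall t, A < `|t| -> phi t = 0 /\ derive1 phi t = 0,
       forall t, `|derive1 phi t| <= B &
       forall s t, `|derive1 phi s - derive1 phi t| <= L * `|s - t|].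
Proof.
move=> M3 [[A0 A0P] [dphi _]].
(* A radius of at least 1 keeps any [t] with [2 * A <= |t|] at distance at least 1 from the
   support. *)
pose A := Num.max A0 1.
have d0 : forall x, derivable phi x 1 by move=> x; apply: (dphi 0%N); lia.
have d1 : forall x, derivable (derive1 phi) x 1 by move=> x; apply: (dphi 1%N); lia.
have d2 : forall x, derivable (derive1 (derive1 phi)) x 1.
  by move=> x; apply: (dphi 2%N); lia.
have s0 t : A < `|t| -> phi t = 0.
  by rewrite gt_max => /andP[/A0P].
have s1 := derive1_eq0_outside s0.
have s2 := derive1_eq0_outside s1.
have [B B0 BP] := derivable_bounded_outside d1 s1.
have [L L0 LP] := derivable_bounded_outside d2 s2.
exists A, B, L; split; first by split; rewrite ?le_max ?lexx ?orbT.
split; [exact: d0| | |exact: BP|].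
- by move=> x; exact/differentiable_continuous/derivable1_diffP.
- by move=> t At; split; [exact: s0|exact: s1].
- exact: (norm_sub_le_derive1 d1 LP).
Qed.

(** * Integrals over bounded sets and against [1 / (t - s)] *)

Lemma norm_Rintegral_le (R : realType) (D : set R) (a b C : R) (g : R -> R) :
  measurable D -> a <= b -> D `<=` `[a, b] -> measurable_fun D g -> 0 <= C ->
  (forall s, D s -> `|g s| <= C) ->
  lebesgue_measure.-integrable D (EFin \o g) /\
  `|\int[lebesgue_measure]_(s in D) g s| <= C * (b - a).
Proof.
move=> mD ab Dab mg C0 gC.
have muD : (lebesgue_measure D <= (b - a)%:E)%E.
  apply: (@le_trans _ _ (lebesgue_measure (`[a, b]%classic : set R))).
    by apply: le_measure => //; rewrite inE.
  by rewrite lebesgue_measure_itv/= lte_fin; case: ifP => // _; rewrite lee_fin subr_ge0.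
have ig : lebesgue_measure.-integrable D (EFin \o g).
  apply: measurable_bounded_integrable => //.
    by rewrite (le_lt_trans muD)// ltry.
  by exists C; split; [exact: num_real|move=> x Cx y Dy; apply: le_trans (gC _ Dy) (ltW Cx)].
split=> //.
rewrite -lee_fin EFin_normr_Rintegral//.
apply: le_trans (le_abse_integral _ _ _) _ => //; first exact: measurable_int ig.
apply: le_trans (integral_le_bound C%:E _ _ _ _) _ => //.
- exact: measurable_int ig.
- by apply: aeW => x Dx; rewrite lee_fin gC.
- by rewrite EFinM lee_wpmul2l// lee_fin.
Qed.

Lemma Rintegral_vanish (R : realType) (D E : set R) (g : R -> R) :
  (forall s, D s -> ~ E s -> g s = 0) ->
  \int[lebesgue_measure]_(s in D) g s =
  \int[lebesgue_measure]_(s in D `&` E) g s.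
Proof.
move=> g0; rewrite [LHS]Rintegral_mkcond [RHS]Rintegral_mkcond.
congr Rintegral; apply/funext => s; rewrite /patch in_setI.
have [|] := boolP (s \in D); rewrite ?inE => Ds //=.
case: ifPn => //; rewrite notin_setE => /(g0 _ Ds) //.
Qed.

Lemma measurable_div_sub (R : realType) (D : set R) (f : R -> R) (t : R) :
  measurable D -> continuous f -> (forall s, D s -> s != t) ->
  measurable_fun D (fun s => f s / (t - s)).
Proof.
move=> mD cf Dt.
apply: (@measurable_funS _ _ _ _ [set s | s != t]) => //.
  rewrite (_ : [set _ | _] = ~` [set t]); first exact: measurableC.
  by apply/seteqP; split=> s /= /eqP.
apply: measurable_realfun.open_continuous_measurable_fun.
  rewrite (_ : [set _ | _] = ~` [set t]).
    by apply: closed_openC; exact: closed_eq.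
  by apply/seteqP; split=> s /= /eqP.
move=> s; rewrite inE/= => st.
apply: cvgM; first exact: cf.
apply: cvgV; first by rewrite subr_eq0 eq_sym.
by apply: cvgB; [exact: cvg_cst|exact: cvg_id].
Qed.

Lemma Rintegral_is_derive (R : realType) (F f : R -> R) (a b : R) :
  a < b -> (forall x, a <= x <= b -> is_derive x 1 F (f x)) ->
  {within `[a, b], continuous f} ->
  \int[lebesgue_measure]_(x in `[a, b]) f x = F b - F a.
Proof.
move=> ab dF cf.
have cF x : a <= x <= b -> {for x, continuous F}.
  by move=> /dF Fx; apply/differentiable_continuous/derivable1_diffP.
rewrite /Rintegral (@continuous_FTC2 _ f F a b)//.
- split.
  + by move=> x; rewrite in_itv/= => /andP[/ltW ax /ltW xb]; have := dF x; rewrite ax xb => /(_ isT) [].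
  + by apply: cvg_at_right_filter; apply: cF; rewrite lexx ltW.
  + by apply: cvg_at_left_filter; apply: cF; rewrite lexx ltW.
- move=> x; rewrite in_itv/= => /andP[/ltW ax /ltW xb].
  by rewrite derive1E; have := dF x; rewrite ax xb => /(_ isT) [].
Qed.

Lemma continuous_within_inv_sub (R : realType) (t a b : R) :
  (forall s, a <= s <= b -> s != t) ->
  {within `[a, b], continuous (fun s : R => (t - s)^-1)}.
Proof.
move=> st; apply: continuous_in_subspaceT => s; rewrite inE/= in_itv/= => /st s0.
apply: cvgV; first by rewrite subr_eq0 eq_sym.
by apply: cvgB; [exact: cvg_cst|exact: cvg_id].
Qed.

(** The primitives [- ln (t - s)] on the left piece and [- ln (s - t)] on the right piece give
    [ln K - ln r] and [ln r - ln K], which cancel. *)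
Lemma Rintegral_inv_annulus (R : realType) (t r K : R) : 0 < r -> r < K ->
  let D := (`[t - K, t - r[ `|` `]t + r, t + K])%classic in
  lebesgue_measure.-integrable D (EFin \o (fun s => (t - s)^-1)) /\
  \int[lebesgue_measure]_(s in D) (t - s)^-1 = 0.
Proof.
move=> r0 rK D.
have mD : measurable D by exact: measurableU.
have iD : lebesgue_measure.-integrable D (EFin \o (fun s => (t - s)^-1)).
  have [||||//|] := @norm_Rintegral_le R D (t - K) (t + K) r^-1 (fun s => (t - s)^-1) mD.
  - by lra.
  - by move=> s [] /=; rewrite !in_itv/= => /andP[? ?]; apply/andP; split; lra.
  - have -> : (fun s => (t - s)^-1) = (fun s => (cst 1 s) / (t - s)).
      by apply/funext => s; rewrite /= mul1r.
    apply: measurable_div_sub => //; first by move=> ?; exact: cvg_cst.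
    by move=> s [] /=; rewrite !in_itv/= => /andP[? ?]; apply/eqP; lra.
  - by rewrite invr_ge0 ltW.
  - move=> s Ds; rewrite normfV lef_pV2 ?posrE//.
      by case: Ds => /=; rewrite !in_itv/= => /andP[? ?]; rewrite lter_normr; apply/orP; [left|right]; lra.
    rewrite normr_gt0 subr_eq0; apply/eqP.
    by case: Ds => /=; rewrite !in_itv/= => /andP[? ?]; lra.
  by [].
split => //.
rewrite Rintegral_setU//; last first.
  apply/disj_setPS => s [] /=; rewrite !in_itv/= => /andP[? ?] /andP[? ?]; lra.
rewrite Rintegral_itv_bndo_bndc; last first.
  by apply: integrableS iD => // s; left.
rewrite Rintegral_itv_obnd_cbnd; last first.
  by apply: integrableS iD => // s; right.
have -> : \int[lebesgue_measure]_(s in `[t - K, t - r]) (t - s)^-1 =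
    - ln (t - (t - r)) - - ln (t - (t - K)).
  apply: (@Rintegral_is_derive _ (fun s => - ln (t - s))).
  - by lra.
  - move=> s /andP[? ?].
    have ts : 0 < t - s by lra.
    have d1 : is_derive s 1 (fun s : R => t - s) (-1).
      have := is_deriveB (is_derive_cst t s 1) (is_derive_id s 1).
      by rewrite sub0r.
    have := is_deriveN (@is_derive1_comp _ (@ln R) (fun s : R => t - s) _ _ _ (is_derive1_ln ts) d1).
    by rewrite mulrN1 opprK.
  - by apply: continuous_within_inv_sub => s /andP[? ?]; apply/eqP; lra.
have -> : \int[lebesgue_measure]_(s in `[t + r, t + K]) (t - s)^-1 =
    - ln (t + K - t) - - ln (t + r - t).
  apply: (@Rintegral_is_derive _ (fun s => - ln (s - t))).
  - by lra.
  - move=> s /andP[? ?].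
    have ts : 0 < s - t by lra.
    have d1 : is_derive s 1 (fun s : R => s - t) 1.
      have := is_deriveB (is_derive_id s 1) (is_derive_cst t s 1).
      by rewrite subr0.
    have := is_deriveN (@is_derive1_comp _ (@ln R) (fun s : R => s - t) _ _ _ (is_derive1_ln ts) d1).
    by rewrite mulr1 -invrN opprB.
  - by apply: continuous_within_inv_sub => s /andP[? ?]; apply/eqP; lra.
rewrite !opprK (_ : t - (t - r) = r); last by lra.
rewrite (_ : t - (t - K) = K); last by lra.
rewrite (_ : t + K - t = K); last by lra.
rewrite (_ : t + r - t = r); last by lra.
by lra.
Qed.

(** * Truncated Hilbert integrals *)

Lemma trunc_setE (R : realType) (t r : R) : 
  [set s : R | r < `|t - s|] = (`]-oo, t - r[ `|` `]t + r, +oo[)%classic.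
Proof.
apply/seteqP; split => s /=; rewrite !in_itv/= ?andbT lter_normr.
  by move=> /orP[] ?; [left|right]; lra.
by move=> []?; apply/orP; [left|right]; lra.
Qed.

Lemma measurable_trunc_set (R : realType) (t r : R) : measurable [set s : R | r < `|t - s|].
Proof. by rewrite trunc_setE; exact: measurableU. Qed.

(** For [|s| <= A] one has [|t - s| >= |t| / 2], so the integrand is at most [2 * B / |t|] on a set
    inside an interval of length [2 * A]. *)
Lemma trunc_hilbert_far (R : realType) (f : R -> R) (A B t r : R) :
  continuous f -> (forall s, A < `|s| -> f s = 0) -> (forall s, `|f s| <= B) ->
  1 <= A -> 0 <= B -> 2 * A <= `|t| -> 0 < r ->
  `|\int[lebesgue_measure]_(s in [set s | r < `|t - s|]) (f s / (t - s))|
     <= 4 * A * B / `|t|.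
Proof.
move=> cf f0 fB A1 B0 tA r0.
have t0 : 0 < `|t| by lra.
rewrite (Rintegral_vanish (E := `[-A, A]%classic)); last first.
  move=> s _ /=; rewrite in_itv/= -ler_norml => /negP; rewrite -ltNge => /f0 ->.
  by rewrite mul0r.
have := @norm_Rintegral_le R ([set s | r < `|t - s|] `&` `[-A, A]) (-A) A (2 * B / `|t|) (fun s => f s / (t - s)).
case.
- by apply: measurableI => //; exact: measurable_trunc_set.
- by lra.
- by move=> s [].
- apply: measurable_div_sub => //.
    by apply: measurableI => //; exact: measurable_trunc_set.
  by move=> s [/= + _]; apply: contraTneq => ->; rewrite subrr normr0 -leNgt ltW.
- by rewrite divr_ge0// ?mulr_ge0.
- move=> s [/= rs]; rewrite in_itv/= -ler_norml => sA.
  have ts : `|t| / 2 <= `|t - s| by have := ler_distD s t 0; rewrite !subr0; lra.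
  rewrite normrM normfV ler_pdivrMr; last by lra.
  apply: le_trans (fB s) _.
  rewrite [leLHS](_ : _ = 2 * B / `|t| * (`|t| / 2)); last by field; lra.
  by rewrite ler_wpM2l// divr_ge0// mulr_ge0.
move=> _ /le_trans; apply.
by rewrite le_eqVlt; apply/orP; left; apply/eqP; field; lra.
Qed.

(* The constant part [f t] of [f] near [t] contributes nothing, because [1 / (t - s)]
   is odd about [t]; the Lipschitz bound makes the rest bounded, uniformly in [r]. *)
Lemma trunc_hilbert_near (R : realType) (f : R -> R) (A L t r : R) :
  continuous f -> (forall s, A < `|s| -> f s = 0) ->
  (forall s s', `|f s - f s'| <= L * `|s - s'|) ->
  1 <= A -> 0 <= L -> `|t| <= 2 * A -> 0 < r < 1 ->
  `|\int[lebesgue_measure]_(s in [set s | r < `|t - s|]) (f s / (t - s))|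
     <= 6 * A * L.
Proof.
move=> cf f0 fL A1 L0 tA /andP[r0 r1].
(* The window of half-width [K] is centred at [t], for the sake of oddness, and contains the support
   because [|t| <= 2 * A]. Its length [6 * A] gives the final constant. *)
set K := 3 * A.
pose D := (`[t - K, t - r[ `|` `]t + r, t + K])%classic.
have mD : measurable D by exact: measurableU.
have rK : r < K by rewrite /K; lra.
have ED : [set s | r < `|t - s|] `&` [set s | `|t - s| <= K] = D.
  apply/seteqP; split => s.
    move=> [/=]; rewrite /D/= !in_itv/= lter_normr ler_norml => /orP[] ? /andP[? ?]; [left|right]; apply/andP; split; lra.
  rewrite /D/= !in_itv/= lter_normr ler_norml => -[] /andP[? ?].
    by split; [apply/orP; left|apply/andP; split]; lra.
  by split; [apply/orP; right|apply/andP; split]; lra.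
rewrite (Rintegral_vanish (E := [set s | `|t - s| <= K])); last first.
  move=> s _ /= /negP; rewrite -ltNge => Ks; rewrite f0 ?mul0r//.
  by have := ler_normB t s; move: Ks; rewrite /K; lra.
rewrite ED.
have Dt s : D s -> s != t.
  by rewrite /D/= !in_itv/= => -[] /andP[? ?]; apply/eqP; lra.
have [iV V0] := Rintegral_inv_annulus t r0 rK; rewrite -/D in iV V0.
have [||||||ig gle] := @norm_Rintegral_le R D (t - K) (t + K) L (fun s => (f s - f t) / (t - s)).
- by [].
- by lra.
- by rewrite /D => s [] /=; rewrite !in_itv/= => /andP[? ?]; apply/andP; split; lra.
- apply: measurable_div_sub => //.
  by move=> s; apply: cvgB; [exact: cf|exact: cvg_cst].
- by [].
- move=> s /Dt st; rewrite normrM normfV ler_pdivrMr; last first.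
    by rewrite normr_gt0 subr_eq0 eq_sym.
  by rewrite (distrC t).
rewrite (@eq_Rintegral _ _ _ lebesgue_measure D (fun s => (f s - f t) / (t - s) + f t * (t - s)^-1)); last first.
  by move=> s _; rewrite mulrBl subrK.
rewrite RintegralD//; last first.
  exact: (@integrableZl _ _ _ lebesgue_measure D mD (f t) _ iV).
rewrite RintegralZl// V0 mulr0 addr0.
apply: le_trans gle _.
by rewrite le_eqVlt; apply/orP; left; apply/eqP; rewrite /K; lra.
Qed.

(* [lim] is the junk value [point] on a divergent filter, so no convergence of the
   principal value is needed. *)
Lemma lim_at_right_le (R : realType) (g : R -> R) (a C : R) :
  (\forall r \near a^'+, `|g r| <= C) -> `|lim (g @ a^'+)| <= Num.max C `|point : R|.
Proof.
move=> gC; rewrite le_max; apply/orP.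
have [cg|dg] := pselect (cvg (g @ a^'+)); last by right; rewrite dvgP.
left; rewrite ler_norml; apply/andP; split.
- by apply: limr_ge => //; apply: filterS gC => r; rewrite ler_norml => /andP[].
- by apply: limr_le => //; apply: filterS gC => r; rewrite ler_norml => /andP[].
Qed.

(** * Upper and lower bounds on the Hilbert transform *)

(** For [s] in [[-A, A]] one has [|t - s| >= A >= 1], so truncation at a radius below 1 removes
    nothing there. The truncated integrals are thus constant near 0. *)
Lemma hilbert_far (R : realType) (f : R -> R) (A t : R) :
  (forall s, A < `|s| -> f s = 0) -> 1 <= A -> 2 * A <= `|t| ->
  hilbert f t = pi^-1 * \int[lebesgue_measure]_(s in `[-A, A]) (f s / (t - s)).
Proof.
move=> f0 A1 tA; rewrite /hilbert; congr (_ * _).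
apply: lim_near_cst; first exact: norm_hausdorff.
near=> r.
have r1 : r < 1 by near: r; apply: nbhs_right_lt.
rewrite (Rintegral_vanish (E := `[-A, A]%classic)); last first.
  move=> s _ /=; rewrite in_itv/= -ler_norml => /negP; rewrite -ltNge => /f0 ->.
  by rewrite mul0r.
congr Rintegral.
apply/seteqP; split => s /=; first by move=> [].
rewrite in_itv/= -ler_norml => sA; split => //.
by have := ler_distD s t 0; rewrite !subr0; lra.
Unshelve. all: by end_near. Qed.

Lemma hilbert_le_inv1D (R : realType) (f : R -> R) (A B L : R) :
  continuous f -> (forall s, A < `|s| -> f s = 0) -> (forall s, `|f s| <= B) ->
  (forall s s', `|f s - f s'| <= L * `|s - s'|) ->
  1 <= A -> 0 <= B -> 0 <= L ->
  exists2 C, 0 <= C & forall t, `|hilbert f t| <= C / (1 + `|t|).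
Proof.
move=> cf f0 fB fL A1 B0 L0.
have pi0 : 0 < pi^-1 :> R by rewrite invr_gt0 pi_gt0.
set m := Num.max (6 * A * L) `|point : R|.
have m0 : 0 <= m by rewrite le_max normr_ge0 orbT.
(* The first summand serves [|t| <= 2 * A], where [1 + |t| <= 1 + 2 * A]; the second serves
   [2 * A <= |t|], where [1 + |t| <= 2 * |t|]. *)
exists (pi^-1 * (m * (1 + 2 * A) + 8 * A * B)) => [|t].
  by rewrite mulr_ge0 ?addr_ge0 ?mulr_ge0//; lra.
rewrite ler_pdivlMr; last by rewrite ltr_wpDr.
have [tA|/ltW tA] := leP `|t| (2 * A).
  have H : `|hilbert f t| <= pi^-1 * m.
    rewrite /hilbert normrM gtr0_norm// ler_wpM2l ?(ltW pi0)//.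
    apply: lim_at_right_le; near=> r.
    apply: (@trunc_hilbert_near _ _ A) => //; apply/andP; split; near: r.
      exact: nbhs_right_gt.
    exact: nbhs_right_lt.
  apply: (@le_trans _ _ (pi^-1 * m * (1 + 2 * A))).
    by apply: ler_pM => //; rewrite ?addr_ge0// lerD2l.
  by rewrite -mulrA ler_wpM2l ?(ltW pi0)// lerDl !mulr_ge0//; lra.
have H : `|hilbert f t| <= pi^-1 * (4 * A * B / `|t|).
  rewrite (hilbert_far f0)// normrM gtr0_norm// ler_wpM2l ?(ltW pi0)//.
  (* A radius below 1 leaves [[-A, A]] intact, so the truncated bound at radius one half applies to
     the full integral. *)
  have := @trunc_hilbert_far _ f A B t 2^-1 cf f0 fB A1 B0 tA.
  rewrite (Rintegral_vanish (E := `[-A, A]%classic)); last first.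
    move=> s _ /=; rewrite in_itv/= -ler_norml => /negP; rewrite -ltNge => /f0 ->.
    by rewrite mul0r.
  rewrite setIidr; first by apply.
  move=> s /=; rewrite in_itv/= -ler_norml => sA.
  by have := ler_distD s t 0; rewrite !subr0; lra.
apply: (@le_trans _ _ (pi^-1 * (4 * A * B / `|t|) * (2 * `|t|))).
  apply: ler_pM => //; rewrite mulr_natl mulr2n lerD2r; apply: le_trans tA; lra.
rewrite (_ : _ * (2 * `|t|) = pi^-1 * (8 * A * B)); last first.
  have t0 : `|t| != 0 by rewrite gt_eqF//; apply: lt_le_trans tA; lra.
  by move: pi^-1 t0 => p t0; field.
by rewrite ler_wpM2l ?(ltW pi0)// lerDr mulr_ge0//; lra.
Unshelve. all: by end_near. Qed.

(** The length 1 of the interval matches the spacing of the integers [j], so that some shift always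
    brings the argument of the kernel into it. *)
Lemma hilbert_derive_ge (R : realType) (phi : R -> R) (A B : R) :
  (forall x, derivable phi x 1) -> continuous (derive1 phi) ->
  (forall t, A < `|t| -> phi t = 0 /\ derive1 phi t = 0) ->
  (forall t, `|derive1 phi t| <= B) -> 1 <= A -> 0 <= B ->
  (\int[lebesgue_measure]_t (phi t)%:E = 1)%E ->
  exists T c : R, 0 < c /\
    forall t, T <= t <= T + 1 -> c <= `|hilbert (derive1 phi) t|.
Proof.
move=> dphi cphi' phi0 phiB A1 B0 int1.
(* Enlarging the radius makes [phi] vanish at [- A'] and [A'] themselves, which removes the boundary
   terms of the integration by parts. *)
set A' := A + 1.
have A'1 : 1 <= A' by rewrite /A'; lra.
have phi0' t : A' <= `|t| -> phi t = 0 /\ derive1 phi t = 0.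
  by rewrite /A' => ?; apply: phi0; lra.
have cphi : continuous phi.
  by move=> x; exact/differentiable_continuous/derivable1_diffP.
have Iphi : \int[lebesgue_measure]_(s in `[-A', A']) phi s = 1.
  rewrite -(setTI `[-A', A']%classic) -Rintegral_vanish ?/Rintegral ?int1//.
  by move=> s _ /=; rewrite in_itv/= -ler_norml => /negP; rewrite -ltNge => /ltW/phi0' [].
(* The first summand puts [t] in the far regime; the second makes the remainder at most half of the
   leading term. *)
pose T := 2 * A' + 8 * A' ^+ 3 * B.
have AB0 : 0 <= A' ^+ 3 * B by rewrite mulr_ge0// exprn_ge0//; lra.
(* The half of [1 / t ^+ 2] that survives the remainder is smallest at [t = T + 1]. *)
exists T, (pi^-1 * (1 / (2 * (T + 1) ^+ 2))).
have T2 : 2 * A' <= T by rewrite /T; lra.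
have pi0 : 0 < pi^-1 :> R by rewrite invr_gt0 pi_gt0.
split; first by rewrite mulr_gt0// divr_gt0// mulr_gt0// exprn_gt0//; lra.
move=> t /andP[tT tT1].
have t0 : 0 < t by lra.
have tA : 2 * A' <= `|t| by rewrite gtr0_norm//; lra.
rewrite (hilbert_far (A := A'))//; last by move=> s /ltW/phi0' [].
rewrite normrM (gtr0_norm pi0) ler_wpM2l ?(ltW pi0)//.
have mI : measurable (`[-A', A']%classic : set R) by [].
have AA : - A' <= A' by lra.
(* [1 / (t - s) = 1 / t + s / t ^+ 2 + s ^+ 2 / (t ^+ 2 * (t - s))]: against [phi'], the
   first two terms integrate to [- 1 / t ^+ 2] by parts, and the last one is [O(1 / t ^+ 3)]. *)
pose F (s : R) := phi s * (t^-1 + s / t ^+ 2).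
pose F' (s : R) := phi s * (t ^+ 2)^-1 + (t^-1 + s / t ^+ 2) * derive1 phi s.
pose rem (s : R) := derive1 phi s * s ^+ 2 / t ^+ 2 / (t - s).
have cF' : continuous F'.
  move=> s; apply: cvgD; first by apply: cvgM; [exact: cphi|exact: cvg_cst].
  apply: cvgM; last exact: cphi'.
  by apply: cvgD; [|apply: cvgM; [exact: cvg_id|]]; exact: cvg_cst.
have IF : \int[lebesgue_measure]_(s in `[-A', A']) F' s = 0.
  have -> : 0 = F A' - F (- A').
    rewrite /F (phi0' A' _).1 ?(phi0' (- A') _).1 ?mul0r ?subrr// ?normrN ger0_norm//; lra.
  apply: Rintegral_is_derive.
  - by lra.
  - move=> s _.
    have d1 : is_derive s 1 phi (derive1 phi s) by rewrite derive1E; exact/derivableP.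
    have d2 : is_derive s 1 (fun s : R => t^-1 + s / t ^+ 2) ((t ^+ 2)^-1).
      by apply: is_derive_eq; rewrite add0r mul1r scaler0 add0r [_ *: _]mulr1.
    exact: is_deriveM.
  - exact: continuous_subspaceT.
have [||||irem remle] := @norm_Rintegral_le R `[-A', A']%classic (-A') A' (2 * A' ^+ 2 * B / t ^+ 3) rem mI AA.
- by [].
- apply: (@measurable_div_sub _ _ (fun s => derive1 phi s * s ^+ 2 / t ^+ 2)) => //.
    move=> s; apply: cvgM; last exact: cvg_cst.
    by apply: cvgM; [exact: cphi'|exact: exprn_continuous].
  by move=> s /=; rewrite in_itv/= => /andP[? ?]; apply/eqP; lra.
- by rewrite divr_ge0 ?exprn_ge0// ?(ltW t0)// mulr_ge0// mulr_ge0// exprn_ge0; lra.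
- move=> s /=; rewrite in_itv/= => /andP[s1 s2].
  have ts : t / 2 <= t - s by lra.
  rewrite /rem 3!normrM !normfV (gtr0_norm (_ : 0 < t - s)); last by lra.
  rewrite (@ger0_norm _ (t ^+ 2)) ?exprn_ge0 ?(ltW t0)//.
  rewrite ler_pdivrMr; last by lra.
  apply: (@le_trans _ _ (B * A' ^+ 2 / t ^+ 2)).
    rewrite ler_wpM2r ?invr_ge0 ?exprn_ge0 ?(ltW t0)//.
    apply: ler_pM => //.
    by rewrite normrX lerXn2r ?nnegrE//; [lra|rewrite ler_norml; lra].
  rewrite [leLHS](_ : _ = 2 * A' ^+ 2 * B / t ^+ 3 * (t / 2)); last by field; lra.
  rewrite ler_wpM2l// divr_ge0 ?exprn_ge0// ?(ltW t0)// mulr_ge0// mulr_ge0// exprn_ge0//; lra.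
have iF' : lebesgue_measure.-integrable (`[-A', A']%classic : set R) (EFin \o F').
  by apply: continuous_compact_integrable; [exact: segment_compact|exact: continuous_subspaceT].
have iphi : lebesgue_measure.-integrable (`[-A', A']%classic : set R) (EFin \o phi).
  by apply: continuous_compact_integrable; [exact: segment_compact|exact: continuous_subspaceT].
have iphit : lebesgue_measure.-integrable (`[-A', A']%classic : set R) (EFin \o (fun s => (t ^+ 2)^-1 * phi s)).
  exact: (@integrableZl _ _ _ lebesgue_measure _ mI (t ^+ 2)^-1 _ iphi).
have -> : \int[lebesgue_measure]_(s in `[-A', A']) (derive1 phi s / (t - s)) =
   \int[lebesgue_measure]_(s in `[-A', A']) rem s - (t ^+ 2)^-1.
  rewrite (@eq_Rintegral _ _ _ lebesgue_measure _
      (fun s => (F' s - (t ^+ 2)^-1 * phi s) + rem s)); last first.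
    move=> s; rewrite inE/= in_itv/= => /andP[s1 s2].
    rewrite /F' /rem; field.
    by rewrite subr_eq0; apply/andP; split; apply/eqP; lra.
  rewrite RintegralD//; last by have H := @integrableB _ _ _ lebesgue_measure _ mI _ _ iF' iphit; exact: H.
  by rewrite RintegralB// IF RintegralZl// Iphi; lra.
have remle' : `|\int[lebesgue_measure]_(s in `[- A', A']) rem s| <= (t ^+ 2)^-1 / 2.
  apply: le_trans remle _.
  rewrite [leLHS](_ : _ = (t ^+ 2)^-1 / 2 * ((8 * (A' ^+ 3 * B)) / t)); last by field; lra.
  rewrite ler_piMr ?divr_ge0 ?invr_ge0 ?exprn_ge0 ?(ltW t0)//.
  by rewrite ler_pdivrMr// mul1r; rewrite /T in tT; lra.
have tt : 1 / (2 * (T + 1) ^+ 2) <= (t ^+ 2)^-1 / 2.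
  rewrite div1r invfM mulrC ler_wpM2r// lef_pV2 ?posrE ?exprn_gt0//; last by lra.
  by rewrite lerXn2r ?nnegrE//; lra.
apply: le_trans tt _.
move: remle'; set I := Rintegral _ _ _; rewrite ler_norml => /andP[? ?].
by rewrite lter_normr; apply/orP; right; lra.
Qed.

(** * Sums over the index set *)

Lemma le_esum_subset (R : realType) (T : choiceType) (A B : set T) (f : T -> \bar R) :
  A `<=` B -> (\esum_(i in A) f i <= \esum_(i in B) f i)%E.
Proof.
move=> AB; apply: ereal_sup_le => _ [X [finX XA] <-].
by exists X => //; split=> //; exact: subset_trans AB.
Qed.

Lemma esum_inj_ord (R : realType) (T : choiceType) (e : nat -> T) (n : nat) (f : T -> \bar R) :
  set_inj `I_n e -> (forall i, (i < n)%N -> (0 <= f (e i))%E) ->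
  (\esum_(x in e @` `I_n) f x = \sum_(i < n) f (e i))%E.
Proof.
move=> ie f0; rewrite esum_image// esum_fset//; last first.
  by move=> i; rewrite inE => /f0.
by rewrite -fsbig_ord.
Qed.

Lemma esum_inv_sqr_nat_le (R : realType) (c : R) : 0 <= c ->
  (\esum_(i in [set: nat]) (c / (1 + i%:R) ^+ 2)%:E <= (2 * c)%:E)%E.
Proof.
move=> c0; have w0 (i : nat) : 0 <= c / (1 + i%:R) ^+ 2.
  by rewrite divr_ge0// exprn_ge0// addr_ge0.
rewrite -nneseries_esumT; last by move=> i; rewrite lee_fin.
apply: lime_le; first by apply: is_cvg_nneseries => i _ _; rewrite lee_fin.
apply: nearW => n; rewrite sumEFin lee_fin.
(* The induction needs a sharper, telescoping bound: [c / (1 + n) ^+ 2] is at most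
   [2 * c / (1 + n) - 2 * c / (2 + n)]. *)
apply: (@le_trans _ _ (2 * c - 2 * c / (1 + n%:R))); last first.
  by rewrite gerBl divr_ge0 ?addr_ge0 ?mulr_ge0.
elim: n => [|n IH]; first by rewrite big_geq// addr0 divr1 subrr.
rewrite big_nat_recr//=; apply: le_trans (lerD IH (lexx _)) _.
have n0 : 0 <= n%:R :> R by [].
rewrite -[n.+1%:R]natr1; move: (n%:R) n0 => x x0.
rewrite -subr_ge0 (_ : _ - _ = c * x / ((1 + x) ^+ 2 * (2 + x))).
  by rewrite divr_ge0 ?mulr_ge0 ?exprn_ge0//; lra.
by field; apply/andP; split; apply/eqP; lra.
Qed.

Lemma esum_inv_sqr_int_le (R : realType) (c : R) : 0 <= c ->
  (\esum_(j in [set: int]) (c / (1 + `|j|%:~R) ^+ 2)%:E <= (4 * c)%:E)%E.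
Proof.
move=> c0; rewrite (esumID (range Posz)); last first.
  by move=> j _; rewrite lee_fin divr_ge0// exprn_ge0// addr_ge0.
rewrite !setTI (_ : 4 * c = 2 * c + 2 * c); last by lra.
rewrite EFinD; apply: leeD.
  rewrite esum_image; first exact: esum_inv_sqr_nat_le.
  by move=> m n _ _ [].
apply: (@le_trans _ _ (\esum_(j in range Negz) (c / (1 + `|j|%:~R) ^+ 2)%:E)%E).
  apply: le_esum_subset => -[n|n] /= nn; last by exists n.
  by exfalso; apply: nn; exists n.
(* [Negz n] stands for [- (n + 1)], so its term is dominated by that of [n]. *)
rewrite esum_image; last by move=> m n _ _ [].
apply: le_trans (esum_inv_sqr_nat_le c0).
apply: le_esum => n _; rewrite lee_fin ler_wpM2l// lef_pV2 ?posrE ?exprn_gt0 ?ltr_wpDr//.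
rewrite lerXn2r ?nnegrE ?addr_ge0// lerD2l NegzE normrN.
by rewrite (_ : n%:R = n%:Z%:~R)// ler_int; lia.
Qed.

(** Reindexing by the floor of [x] reduces the shift to [[0, 1)]. This costs a factor 2 in
    [1 + |j|], hence 4 after squaring, on top of the 4 of the unshifted sum. *)
Lemma esum_inv_sqr_shift_le (R : realType) (c x : R) : 0 <= c ->
  (\esum_(j in [set: int]) (c / (1 + `|x - j%:~R|) ^+ 2)%:E <= (16 * c)%:E)%E.
Proof.
move=> c0; set n := Num.floor x.
rewrite (reindex_esum setT _ (fun j => n + j)); last first.
  split; [by []|by move=> i j _ _ /addrI|].
  by move=> j _; exists (j - n) => //; rewrite addrC subrK.
have c40 : 0 <= 4 * c by lra.
rewrite (_ : 16 * c = 4 * (4 * c)); last by lra.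
apply: le_trans (esum_inv_sqr_int_le c40).
apply: le_esum => j _; rewrite lee_fin.
have /andP[n1 n2] := floor_itv x.
rewrite -/n intrD in n1 n2.
have H : 1 + `|j|%:~R <= 2 * (1 + `|x - (n + j)%:~R|) :> R.
  rewrite intrD intr_norm.
  have : `|j%:~R : R| <= `|x - (n%:~R + j%:~R)| + 1.
    rewrite [in leLHS](_ : j%:~R = (x - n%:~R) - (x - (n%:~R + j%:~R)) :> R); last by lra.
    have xn : `|x - n%:~R| <= 1 by rewrite ger0_norm; lra.
    by apply: le_trans (ler_normB _ _) _; rewrite addrC lerD2l.
  by have := normr_ge0 (x - (n%:~R + j%:~R)); lra.
have p1 : 0 < 1 + `|x - (n + j)%:~R| by rewrite ltr_wpDr.
have p2 : 0 < 1 + `|j|%:~R :> R by rewrite ltr_wpDr.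
rewrite ler_pdivrMr ?exprn_gt0// mulrAC ler_pdivlMr ?exprn_gt0//.
rewrite -mulrA (mulrC 4) -mulrA ler_wpM2l//.
rewrite (_ : _ * 4 = (2 * (1 + `|x - (n + j)%:~R|)) ^+ 2); last by ring.
by rewrite lerXn2r ?nnegrE ?mulr_ge0// ltW.
Qed.

(** At most [2 * m + 1] values of [k] occur, with [m] the integer part of [pi / h]. Since
    [pi / h >= 1], this is at most [3 * pi / h]. *)
Lemma esum_alpha_k_le (R : realType) (h c : R) : 0 < h -> h <= pi -> 0 <= c ->
  (\esum_(k in [set k : int | (`|k%:~R * h| <= pi)%R]) c%:E <= (3 * pi / h * c)%:E)%E.
Proof.
move=> h0 hpi c0.
set x := pi / h.
have x1 : 1 <= x by rewrite ler_pdivlMr// mul1r.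
have x0 : 0 <= x by lra.
set m := Num.truncn x.
have /andP[m1 m2] := Num.Theory.truncn_itv x0.
rewrite -/m in m1 m2.
apply: (@le_trans _ _ (\esum_(k in (fun i : nat => (i%:Z - m%:Z)%R) @` `I_(2 * m + 1)) c%:E)%E).
  apply: le_esum_subset => k /=.
  rewrite normrM (gtr0_norm h0) -ler_pdivlMr// -/x -intr_norm => kx.
  have km : `|k| < m.+1%:Z by rewrite -(ltr_int R); apply: le_lt_trans kx m2.
  by exists (absz (k + m%:Z)); lia.
rewrite esum_inj_ord//.
  rewrite sumEFin lee_fin sumr_const card_ord -[leLHS]mulr_natl ler_wpM2r//.
  by rewrite -mulrA -/x natrD natrM; lra.
by move=> i j _ _ /addIr [].
Qed.

Lemma index_setE (R : realType) (kappa eps : R) :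
  index_set kappa eps = [set k : int | `|k%:~R * (kappa * eps)| <= pi] `*`` (fun=> setT).
Proof. by apply/seteqP; split => -[k j] //= []. Qed.

(** Summing over [j] first costs [16 * c] for each [k], uniformly in the centre [a k]; the count of
    [k] supplies the factor [3 * pi / (kappa * eps)]. *)
Lemma esum_index_set_le (R : realType) (kappa eps c : R) (a : int -> R)
    (f : int * int -> \bar R) :
  0 < kappa * eps -> kappa * eps <= pi -> 0 <= c ->
  (forall kj, index_set kappa eps kj ->
     (f kj <= (c / (1 + `|a kj.1 - kj.2%:~R|) ^+ 2)%:E)%E) ->
  (\esum_(kj in index_set kappa eps) f kj <= (48 * pi * c / (kappa * eps))%:E)%E.
Proof.
move=> h0 hpi c0 fle.
apply: le_trans (le_esum fle) _.
rewrite index_setE.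
rewrite -(@esum_esum _ _ _ _ (fun=> setT) (fun k j => (c / (1 + `|a k - j%:~R|) ^+ 2)%:E)); last first.
  by move=> i j _ _; rewrite lee_fin divr_ge0// exprn_ge0// addr_ge0.
apply: (@le_trans _ _ (\esum_(k in [set k : int | (`|k%:~R * (kappa * eps)| <= pi)%R]) (16 * c)%:E)%E).
  by apply: le_esum => k _; exact: esum_inv_sqr_shift_le.
have c160 : 0 <= 16 * c by lra.
apply: le_trans (esum_alpha_k_le h0 hpi c160) _.
by rewrite lee_fin le_eqVlt; apply/orP; left; apply/eqP; ring.
Qed.

Lemma esum_ge_inj_ord (R : realType) (T : choiceType) (A : set T) (e : nat -> T) (n : nat)
    (f : T -> \bar R) (v : R) :
  0 <= v -> set_inj `I_n e -> (forall i, (i < n)%N -> A (e i) /\ (v%:E <= f (e i))%E) ->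
  ((n%:R * v)%:E <= \esum_(x in A) f x)%E.
Proof.
move=> v0 ie H.
apply: (@le_trans _ _ (\esum_(x in e @` `I_n) f x)%E); last first.
  by apply: le_esum_subset => _ [i /= /H[Ai _] <-].
rewrite esum_inj_ord//; last first.
  by move=> i /H[_]; apply: le_trans; rewrite lee_fin.
apply: (@le_trans _ _ (\sum_(i < n) v%:E)%E).
  by rewrite sumEFin lee_fin sumr_const card_ord mulr_natl.
by apply: lee_sum => i _; apply: (H i _).2.
Qed.

(** * Numerator and denominator *)

Lemma dir_lipschitz (R : realType) (a b : R) (x : R * R) :
  `|dir a x - dir b x| <= (`|x.1| + `|x.2|) * `|a - b|.
Proof.
have Hc : `|cos a - cos b| <= 1 * `|a - b|.
  apply: norm_sub_le_derive1 => [z|z]; first exact: derivable_cos.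
  by rewrite derive1E derive_val normrN sin_max.
have Hs : `|sin a - sin b| <= 1 * `|a - b|.
  apply: norm_sub_le_derive1 => [z|z]; first exact: derivable_sin.
  by rewrite derive1E derive_val cos_max.
rewrite /dir (_ : _ - _ = (cos a - cos b) * x.1 + (sin a - sin b) * x.2); last by ring.
apply: le_trans (ler_normD _ _) _; rewrite !normrM mulrDl.
by apply: lerD; rewrite mulrC ler_wpM2l// -[leRHS]mul1r.
Qed.

Lemma norm_dir_le (R : realType) (a : R) (x : R * R) : `|dir a x| <= `|x.1| + `|x.2|.
Proof.
apply: le_trans (ler_normD _ _) _; rewrite !normrM.
by apply: lerD; rewrite ler_piMl// ?cos_max ?sin_max.
Qed.

Lemma dirD2pi (R : realType) (a : R) (x : R * R) : dir (a + 2 * pi) x = dir a x.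
Proof. by rewrite /dir mulr_natl cosD2pi sinD2pi. Qed.

Lemma sigma_lipschitz (R : realType) (sigma : R -> R -> R) : sigma_ok sigma ->
  exists2 B, 0 < B & (forall a p, `|sigma a p| <= B) /\
    forall a a' p p', `|sigma a p - sigma a' p'| <= B * (`|a - a'| + `|p - p'|).
Proof.
move=> [_ [da [dp [_ [_ [B BP]]]]]].
have B0 : 0 <= B by have [+ _] := BP 0 0; exact: le_trans.
(* The added 1 makes the constant positive; it is divided by later. *)
exists (B + 1); first by lra.
split=> [a p|a a' p p']; first by have [+ _] := BP a p; lra.
have H1 := @norm_sub_le_derive1 R (fun a => sigma a p) B (da^~ p) (fun a => (BP a p).2.1) a a'.
have H2 := @norm_sub_le_derive1 R (sigma a') B (dp a') (fun p => (BP a' p).2.2) p p'.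
rewrite (_ : _ - _ = (sigma a p - sigma a' p) + (sigma a' p - sigma a' p')); last by ring.
apply: le_trans (ler_normD _ _) _; rewrite mulrDr; apply: lerD.
  by apply: le_trans H1 _; rewrite ler_wpM2r// lerDl.
by apply: le_trans H2 _; rewrite ler_wpM2r// lerDl.
Qed.

(** By the Lipschitz bound, [sigma] keeps at least half of its nonzero size near one point. The
    tolerance [rho] is there because the grid values [p_j] only approximate [dir al x0]. *)
Lemma sigma_sqr_ge (R : realType) (sigma : R -> R -> R) (x0 : R * R) (a0 : R) :
  sigma_ok sigma -> 0 <= a0 <= 2 * pi -> sigma a0 (dir a0 x0) ^+ 2 != 0 ->
  exists a b v rho : R, [/\ - pi <= a, a < b, b <= pi, 0 < v & 0 < rho] /\
    forall al p, a <= al <= b -> `|p - dir al x0| <= rho -> v <= sigma al p ^+ 2.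
Proof.
move=> sok /andP[a00 a02] s00.
have [B B0 [_ sL]] := sigma_lipschitz sok.
have [sper _] := sok.
have pi0 := pi_gt0 R.
(* The angle [a0] lies in [[0, 2 * pi]], those of the index set in [[- pi, pi]]; periodicity moves
   one to the other. *)
have [b0 [/andP[b01 b02] sb0]] : exists b0, - pi <= b0 <= pi /\ sigma b0 (dir b0 x0) ^+ 2 != 0.
  have [ap|ap] := leP a0 pi; first by exists a0; split => //; apply/andP; split; lra.
  exists (a0 - 2 * pi); split; first by apply/andP; split; lra.
  by rewrite -sper -dirD2pi subrK.
set s0 := sigma b0 (dir b0 x0) in sb0.
have s0p : 0 < `|s0| by rewrite normr_gt0; apply: contra_neq sb0 => ->; rewrite expr0n.
set X := `|x0.1| + `|x0.2|.
have X0 : 0 <= X by rewrite addr_ge0.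
(* The variation of [sigma] is at most [B * (r * (1 + X) + rho)], and [r * (1 + X) <= rho] turns
   this into [2 * B * rho = |s0| / 2]. *)
pose rho := `|s0| / (4 * B).
have rho0 : 0 < rho by rewrite divr_gt0// mulr_gt0.
pose r := Num.min pi (rho / (1 + X)).
have r0 : 0 < r by rewrite lt_min pi0 divr_gt0//; lra.
have rpi : r <= pi by rewrite ge_min lexx.
have rX : r * (1 + X) <= rho by rewrite -ler_pdivlMr; [rewrite ge_min lexx orbT|lra].
have key al p : `|al - b0| <= r -> `|p - dir al x0| <= rho -> (`|s0| / 2) ^+ 2 <= sigma al p ^+ 2.
  move=> alb palb.
  have : `|sigma al p - s0| <= `|s0| / 2.
    apply: le_trans (sL _ _ _ _) _.
    have : `|p - dir b0 x0| <= rho + X * r.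
      rewrite (_ : p - _ = (p - dir al x0) + (dir al x0 - dir b0 x0)); last by ring.
      apply: le_trans (ler_normD _ _) _; apply: lerD => //.
      by apply: le_trans (dir_lipschitz _ _ _) _; rewrite ler_wpM2l.
    move=> H; apply: (@le_trans _ _ (B * (2 * rho))).
      by rewrite ler_wpM2l ?(ltW B0)//; lra.
    by rewrite le_eqVlt /rho; apply/orP; left; apply/eqP; field; lra.
  move=> H; rewrite -[leRHS]real_normK ?num_real//.
  rewrite lerXn2r ?nnegrE ?divr_ge0//.
  by have := ler_normB (sigma al p) (sigma al p - s0); rewrite opprB addrC subrK; lra.
(* The interval extends from [b0] in the direction of 0, so that [r <= pi] keeps it inside
   [[- pi, pi]]. *)
have [b00|b00] := leP b0 0.
  exists b0, (b0 + r), ((`|s0| / 2) ^+ 2), rho; split.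
    by split=> //; rewrite ?exprn_gt0 ?divr_gt0//; lra.
  by move=> al p /andP[? ?]; apply: key; rewrite ger0_norm; lra.
exists (b0 - r), b0, ((`|s0| / 2) ^+ 2), rho; split.
  by split=> //; rewrite ?exprn_gt0 ?divr_gt0//; lra.
by move=> al p /andP[? ?]; apply: key; rewrite ler0_norm; lra.
Qed.

(** One of the three decay factors is given up to reach inverse squares. With [h = kappa * eps], the
    third moments bring [h] to the power 3/2 and the number of angles brings [1 / h], which leaves
    [Num.sqrt h]. *)
Lemma numer_le (R : realType) (kappa pbar : R) (x0 xc : R * R) (phi : R -> R)
    (d : measure_display) (T : measurableType d) (P : probability T R)
    (eta : R -> int -> int -> T -> R) (C c eps : R) :
  0 < kappa * eps -> kappa * eps <= pi -> 0 <= C -> 0 <= c ->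
  (forall t, `|hilbert (derive1 phi) t| <= C / (1 + `|t|)) ->
  (forall k j, index_set kappa eps (k, j) ->
    (\int[P]_w (`|eta eps k j w| ^+ 3)%:E <= (c * (kappa * eps) `^ (3 / 2))%:E)%E) ->
  (0 <= numer P kappa pbar x0 xc phi eta eps <=
    (48 * pi * C ^+ 3 * c * Num.sqrt (kappa * eps))%:E)%E.
Proof.
move=> h0 hpi C0 c0 HC Hc; apply/andP; split.
  apply: esum_ge0 => kj _; apply: mule_ge0; first by rewrite lee_fin.
  by apply: integral_ge0 => w _; rewrite lee_fin.
pose t k := (dir (alpha_k kappa eps k) x0 - pbar) / eps + dir (alpha_k kappa eps k) xc.
pose h := kappa * eps.
have c1 : 0 <= C ^+ 3 * (c * h `^ (3 / 2)) by rewrite !mulr_ge0 ?exprn_ge0 ?powR_ge0.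
rewrite (_ : 48 * pi * C ^+ 3 * c * _ = 48 * pi * (C ^+ 3 * (c * h `^ (3 / 2))) / h).
  apply: (esum_index_set_le (a := t)) => // -[k j] /= kj.
  rewrite -[leRHS](_ : ((C / (1 + `|t k - j%:~R|)) ^+ 3 * (1 + `|t k - j%:~R|))%:E * (c * h `^ (3 / 2))%:E = _)%E.
    apply: lee_pmul => //; last exact: Hc.
    - by apply: integral_ge0 => w _; rewrite lee_fin.
    - rewrite lee_fin (_ : arg_kj _ _ _ _ _ _ _ = t k - j%:~R); last by rewrite /arg_kj /t; ring.
      apply: (@le_trans _ _ ((C / (1 + `|t k - j%:~R|)) ^+ 3)).
        by rewrite lerXn2r ?nnegrE// ?divr_ge0// addr_ge0.
      by rewrite ler_peMr ?exprn_ge0 ?divr_ge0 ?addr_ge0// lerDl.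
  rewrite -EFinM; congr EFin; field.
  by rewrite gt_eqF// ltr_wpDr.
have hn0 : h != 0 by rewrite gt_eqF.
rewrite (_ : 3 / 2 = 1 + 2^-1); last by lra.
rewrite powRD; last by rewrite hn0 implybT.
rewrite powRr1 ?(ltW h0)// powR12_sqrt ?(ltW h0)//.
by rewrite -/h; move: (pi : R) (Num.sqrt h) => p s; field.
Qed.

(** The factor [kappa * eps] in the variance cancels the growth of the number of angles. The bound
    serves to show that the denominator is finite. *)
Lemma denom_le (R : realType) (kappa pbar : R) (x0 xc : R * R) (phi : R -> R)
    (d : measure_display) (T : measurableType d) (P : probability T R)
    (eta : R -> int -> int -> T -> R) (sigma : R -> R -> R) (C B eps : R) :
  0 < kappa * eps -> kappa * eps <= pi -> 0 <= C ->
  (forall t, `|hilbert (derive1 phi) t| <= C / (1 + `|t|)) ->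
  (forall a p, `|sigma a p| <= B) ->
  (forall k j, index_set kappa eps (k, j) ->
    (\int[P]_w (eta eps k j w ^+ 2)%:E =
     (sigma (alpha_k kappa eps k) (p_j pbar eps j) ^+ 2 * (kappa * eps))%:E)%E) ->
  (denom P kappa pbar x0 xc phi eta eps <= (48 * pi * C ^+ 2 * B ^+ 2)%:E)%E.
Proof.
move=> h0 hpi C0 HC HB Hs.
pose t k := (dir (alpha_k kappa eps k) x0 - pbar) / eps + dir (alpha_k kappa eps k) xc.
set h := kappa * eps in h0 hpi Hs *.
have c1 : 0 <= C ^+ 2 * (B ^+ 2 * h) by rewrite mulr_ge0 ?sqr_ge0// mulr_ge0 ?sqr_ge0// ltW.
rewrite (_ : 48 * pi * C ^+ 2 * _ = 48 * pi * (C ^+ 2 * (B ^+ 2 * h)) / h); last first.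
  by have hn0 : h != 0 by [rewrite gt_eqF]; move: (pi : R) => p; field.
apply: (esum_index_set_le (a := t)) => // -[k j] /= kj.
rewrite Hs// -EFinM lee_fin (_ : arg_kj _ _ _ _ _ _ _ = t k - j%:~R); last by rewrite /arg_kj /t; ring.
rewrite [leRHS](_ : _ = (C / (1 + `|t k - j%:~R|)) ^+ 2 * (B ^+ 2 * h)); last first.
  by field; rewrite gt_eqF// ltr_wpDr.
apply: ler_pM; [exact: sqr_ge0|by rewrite mulr_ge0 ?sqr_ge0 ?(ltW h0)| |].
  rewrite -real_normK ?num_real// lerXn2r ?nnegrE ?divr_ge0 ?addr_ge0//.
rewrite ler_wpM2r ?(ltW h0)// -real_normK ?num_real// lerXn2r ?nnegrE//.
exact: le_trans (HB 0 0).
Qed.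

(** A single well-chosen [j] for each angle in [[a, b]] contributes at least
    [c ^+ 2 * v * (kappa * eps)], and the number of these angles compensates the factor
    [kappa * eps]. *)
Lemma denom_ge (R : realType) (kappa pbar : R) (x0 xc : R * R) (phi : R -> R)
    (d : measure_display) (T : measurableType d) (P : probability T R)
    (eta : R -> int -> int -> T -> R) (sigma : R -> R -> R)
    (t0 c a b v rho eps : R) :
  0 < kappa -> 0 < eps -> 2 * (kappa * eps) <= b - a ->
  - pi <= a -> a < b -> b <= pi -> 0 <= v -> 0 <= c ->
  eps * (`|xc.1| + `|xc.2| + `|t0| + 1) <= rho ->
  (forall t, t0 <= t <= t0 + 1 -> c <= `|hilbert (derive1 phi) t|) ->
  (forall al p, a <= al <= b -> `|p - dir al x0| <= rho -> v <= sigma al p ^+ 2) ->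
  (forall k j, index_set kappa eps (k, j) ->
    (\int[P]_w (eta eps k j w ^+ 2)%:E =
     (sigma (alpha_k kappa eps k) (p_j pbar eps j) ^+ 2 * (kappa * eps))%:E)%E) ->
  (((b - a) / 2 * (c ^+ 2 * v))%:E <= denom P kappa pbar x0 xc phi eta eps)%E.
Proof.
move=> k0 e0 hab api ab bpi v0 c0 erho Hc Hv Hs.
set h := kappa * eps in hab Hs.
have h0 : 0 < h by rewrite mulr_gt0.
have x0' : 0 <= (b - a) / h by rewrite divr_ge0 ?(ltW h0)//; lra.
(* From [b - a < (n + 1) * h] and [2 * h <= b - a] it follows that [n * h] exceeds [(b - a) / 2]. *)
set n := Num.truncn ((b - a) / h).
have /andP[n1 n2] := Num.Theory.truncn_itv x0'.
rewrite -/n ler_pdivlMr// in n1.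
rewrite -/n ltr_pdivrMr// -natr1 in n2.
(* The first grid angle strictly above [a] is [(m + 1) * h], at most [a + h]; hence for [i < n] the
   angles [al i] are at most [a + n * h <= b]. *)
pose m := Num.floor (a / h).
have /andP[m1 m2] := floor_itv (a / h).
rewrite -/m ler_pdivlMr// in m1.
rewrite -/m ltr_pdivrMr// intrD in m2.
pose k (i : nat) : int := m + 1 + i%:Z.
pose al i := alpha_k kappa eps (k i).
pose t i := (dir (al i) x0 - pbar) / eps + dir (al i) xc.
(* The floor places the argument [t i - j i] of the kernel in [[t0, t0 + 1)]. *)
pose j i := Num.floor (t i - t0).
have alE i : al i = (m%:~R + 1) * h + i%:R * h.
  by rewrite /al /alpha_k /k !intrD -/h; ring.
have alab i : (i < n)%N -> a <= al i <= b.
  move=> ilt; rewrite alE.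
  have i0 : 0 <= i%:R * h by rewrite mulr_ge0 ?(ltW h0).
  have iN : i%:R * h + h <= n%:R * h.
    by rewrite -[X in _ + X]mul1r -mulrDl natr1 ler_wpM2r ?(ltW h0)// ler_nat.
  by apply/andP; split; lra.
have ik i : (i < n)%N -> index_set kappa eps (k i, j i).
  by move=> /alab /andP[? ?]; rewrite /index_set/= ler_norml; apply/andP; split; rewrite -/(al i); lra.
apply: (@le_trans _ _ (n%:R * (c ^+ 2 * (v * h)))%:E).
  rewrite lee_fin (_ : n%:R * _ = n%:R * h * (c ^+ 2 * v)); last by ring.
  by rewrite ler_wpM2r ?mulr_ge0 ?sqr_ge0//; lra.
apply: (@esum_ge_inj_ord _ _ _ (fun i => (k i, j i))).
- by rewrite mulr_ge0 ?sqr_ge0// mulr_ge0 // ltW.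
- by move=> i i' _ _ [/addrI [->]].
move=> i ilt; split; first exact: ik.
rewrite /= Hs; last exact: ik.
rewrite -EFinM lee_fin -/h -/(al i).
have argE : arg_kj kappa pbar eps x0 xc (k i) (j i) = t i - (j i)%:~R.
  by rewrite /arg_kj /t /al; ring.
have /andP[j1 j2] := floor_itv (t i - t0).
rewrite -/(j i) in j1 j2; rewrite intrD in j2.
apply: ler_pM; [exact: sqr_ge0|by rewrite mulr_ge0// ltW| |].
  rewrite -[leRHS]real_normK ?num_real// lerXn2r ?nnegrE//.
  by apply: Hc; rewrite argE; apply/andP; split; lra.
rewrite ler_wpM2r ?(ltW h0)//; apply: Hv; first exact: alab.
apply: le_trans erho.
(* The deviation of [p_j] from [dir (al i) x0] is [eps] times a bounded quantity, because the
   argument of the kernel is confined between [t0] and [t0 + 1]. *)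
rewrite (_ : _ - _ = eps * (dir (al i) xc - (t i - (j i)%:~R))); last first.
  by rewrite /p_j /t; field; rewrite gt_eqF.
rewrite normrM gtr0_norm// ler_wpM2l ?(ltW e0)//.
apply: le_trans (ler_normB _ _) _.
rewrite -[leRHS]addrA; apply: lerD; first exact: norm_dir_le.
have := ler_norm t0; have := ler_norm (- t0); rewrite normrN => ? ?.
by rewrite ler_norml; apply/andP; split; lra.
Qed.

(** * Choice of the constants and the final estimate *)

Theorem theorem1 (R : realType) (kappa pbar : R) (x0 xc : R * R)
    (sigma : R -> R -> R) (phi : R -> R) (M : nat) (nu : R)
    (d : measure_display) (T : measurableType d) (P : probability T R)
    (eta : R -> int -> int -> T -> R) :
  0 < kappa ->
  noise_ok P kappa pbar sigma eta ->
  sigma_ok sigma ->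
  (3 <= M)%N ->
  kernel_ok M phi ->
  0 < nu ->
  of_type (kappa * norm2 x0) nu ->
  nu + 1 < M%:R ->
  (exists Omega : set R, open Omega /\ Omega !=set0 /\
     Omega `<=` [set a | 0 <= a <= 2 * pi] /\
     forall a, Omega a -> (sigma a (dir a x0)) ^+ 2 != 0) ->
  exists C eps0 : R, 0 < eps0 /\
    forall eps : R, 0 < eps < eps0 ->
      let N := numer P kappa pbar x0 xc phi eta eps in
      let D := denom P kappa pbar x0 xc phi eta eps in
      N \is a fin_num /\ D \is a fin_num /\ 0 < fine D /\
      fine N / (fine D `^ (3 / 2)) <= C * Num.sqrt eps.
Proof.
move=> k0 [_ [_ [Hs [c3 Hc3]]]] sok M3 kok _ _ _ [U [_ [[a0 Oa0] [UI Os]]]].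
have pi0 := pi_gt0 R.
have int1 := kok.2.2.2.
have [A [B [L [[A1 B0 L0] [dphi cphi' phi0 phiB phiL]]]]] := kernel_facts M3 kok.
have phi0' t : A < `|t| -> derive1 phi t = 0 by move=> /phi0 [].
have [C C0 HC] := hilbert_le_inv1D cphi' phi0' phiB phiL A1 B0 L0.
have [t0 [c [c0 Hc]]] := hilbert_derive_ge dphi cphi' phi0 phiB A1 B0 int1.
have [S S0 [HS _]] := sigma_lipschitz sok.
have [a [b [v [rho [[api ab bpi v0 rho0] Hv]]]]] := sigma_sqr_ge sok (UI _ Oa0) (Os _ Oa0).
pose d0 := (b - a) / 2 * (c ^+ 2 * v).
have d00 : 0 < d0 by rewrite !mulr_gt0 ?exprn_gt0//; lra.
(* The constant in [noise_ok] comes without a sign. *)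
pose c3' := Num.max c3 0.
have c30 : 0 <= c3' by rewrite le_max lexx orbT.
have Hc3' eps k j : 0 < eps -> index_set kappa eps (k, j) ->
    (\int[P]_w (`|eta eps k j w| ^+ 3)%:E <= (c3' * (kappa * eps) `^ (3 / 2))%:E)%E.
  move=> e0 kj; apply: le_trans (Hc3 _ _ _ e0 kj) _.
  by rewrite lee_fin ler_wpM2r ?powR_ge0// le_max lexx.
pose q := `|xc.1| + `|xc.2| + `|t0| + 1.
have q0 : 0 < q by rewrite ltr_wpDl// !addr_ge0.
exists (48 * pi * C ^+ 3 * c3' * Num.sqrt kappa / d0 `^ (3 / 2)).
(* The three thresholds ensure, in this order, [kappa * eps <= pi], [2 * (kappa * eps) <= b - a] and
   [eps * q <= rho]. *)
exists (Num.min (pi / kappa) (Num.min ((b - a) / 2 / kappa) (rho / q))).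
split; first by rewrite !lt_min !divr_gt0//; lra.
move=> eps /andP[e0]; rewrite !lt_min => /and3P[+ + +] N D.
rewrite !ltr_pdivlMr// ![eps * kappa]mulrC => /ltW hpi hab /ltW erho.
have h0 : 0 < kappa * eps by rewrite mulr_gt0.
have Hs' k j := Hs eps k j e0.
have Hc3'' k j := Hc3' eps k j e0.
have /andP[N0 NC] := numer_le pbar x0 xc h0 hpi C0 c30 HC Hc3''.
have DC := denom_le x0 xc h0 hpi C0 HC HS Hs'.
have hab' : 2 * (kappa * eps) <= b - a by lra.
have D0 := denom_ge k0 e0 hab' api ab bpi (ltW v0) (ltW c0) erho Hc Hv Hs'.
rewrite -/N in N0 NC; rewrite -/D in DC; rewrite -/D -/d0 in D0.
(* As [fine] sends infinite values to 0, finiteness is what ties the real quotient to the two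
   sums. *)
have Nfin : N \is a fin_num.
  by rewrite ge0_fin_numE//; apply: le_lt_trans NC _; rewrite ltry.
have Dfin : D \is a fin_num.
  rewrite ge0_fin_numE; first by apply: le_lt_trans DC _; rewrite ltry.
  by apply: le_trans D0; rewrite lee_fin ltW.
have d0D : d0 <= fine D by rewrite -lee_fin fineK.
have NN : fine N <= 48 * pi * C ^+ 3 * c3' * Num.sqrt (kappa * eps) by rewrite -lee_fin fineK.
have DD : d0 `^ (3 / 2) <= fine D `^ (3 / 2).
  by apply: ge0_ler_powR; rewrite ?nnegrE ?(ltW d00) ?(ltW (lt_le_trans d00 d0D))//; lra.
do 3 split=> //; first exact: lt_le_trans d0D.
have d1 := powR_gt0 (3 / 2) d00.
apply: (@le_trans _ _ (fine N / d0 `^ (3 / 2))).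
  rewrite ler_wpM2l ?fine_ge0// lef_pV2 ?posrE//.
  exact: lt_le_trans DD.
rewrite [leRHS](_ : _ = 48 * pi * C ^+ 3 * c3' * Num.sqrt (kappa * eps) / d0 `^ (3 / 2)).
  by rewrite ler_wpM2r// invr_ge0 ltW.
by rewrite sqrtrM ?(ltW k0)//; ring.
Qed.
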